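(* For all positive integers $m$ and $n$, the number $D_P^{(m,n)}$ of period knot $(m,n)$-mosaics and the number $D_T^{(m,n)}$ of toroidal knot $(m,n)$-mosaics satisfy $$\frac{1}{mn}\, D_{P}^{(m,n)} \leq D_{T}^{(m,n)} \leq D_{P}^{(m,n)}.$$
   Context: Mosaic tiles: there are eleven tiles $T_0,\dots,T_{10}$ (unit squares with curves drawn on them). A connection point of a tile is the midpoint of an edge (left, right, top, bottom) of the tile that is an endpoint of a curve drawn on the tile. The sets of edges carrying connection points are as follows: $T_0$: none; $T_1$: left, bottom; $T_2$: right, bottom; $T_3$: right, top; $T_4$: left, top; $T_5$: left, right; $T_6$: top, bottom; $T_7,T_8,T_9,T_{10}$: all four edges. Thus each two-element set of edges occurs for exactly one tile, the empty set for exactly one tile, and the full set for exactly four (distinct) tiles. For positive integers $m,n$, an $(m,n)$-mosaic is an $m\times n$ matrix $M=(M_{ij})$ of mosaic tiles (row 1 at the top, column 1 at the left). It is suitably connected if any two tiles immediately next to each other in the same row or the same column either both have or both do not have a connection point on their common edge. It is suitably $\partial$-connected if for each row, the leftmost tile has a connection point on its left edge if and only if the rightmost tile has one on its right edge, and for each column, the topmost tile has a connection point on its top edge if and only if the bottommost tile has one on its bottom edge (when $n=1$ or $m=1$ the two tiles in question coincide). A period knot $(m,n)$-mosaic is a suitably connected and suitably $\partial$-connected $(m,n)$-mosaic; $D_P^{(m,n)}$ denotes the number of these. Two period knot $(m,n)$-mosaics are equivalent if one can be obtained from the other by a finite sequence of cyclic rotations of rows and columns, i.e. if for some integers $x,y$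 one is $(M_{ij})$ and the other is $(M_{i-x,j-y})$, with row indices taken modulo $m$ and column indices modulo $n$. (Tiles themselves are not rotated.) A toroidal knot $(m,n)$-mosaic is an equivalence class of period knot $(m,n)$-mosaics; $D_T^{(m,n)}$ denotes the number of these classes. *)

(* Defs.v *)
From mathcomp Require Import all_boot all_order all_algebra.
From mathcomp Require Import boolp.

Set Implicit Arguments.
Unset Strict Implicit.
Unset Printing Implicit Defensive.

Inductive edge := Left | Right | Top | Bottom.

(* The ordinal k stands for the tile T_k. *)
Definition tile := 'I_11.

(* The curves drawn on a tile matter only through their end points; T_7, ...,
   T_10 all meet the four edges but remain distinct tiles. *)
Definition connection_point (T : tile) (e : edge) : bool :=
  match nat_of_ord T, e with
  | 0, _ => false
  | 1, (Left | Bottom) => true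
  | 2, (Right | Bottom) => true
  | 3, (Right | Top) => true
  | 4, (Left | Top) => true
  | 5, (Left | Right) => true
  | 6, (Top | Bottom) => true
  | (1 | 2 | 3 | 4 | 5 | 6), _ => false
  | _, _ => true
  end.

(* Row 0 is the top row and column 0 the leftmost column. *)
Definition mosaic (m n : nat) := 'M[tile]_(m, n).

Definition suitably_connected (m n : nat) (M : mosaic m n) : bool :=
  [forall i : 'I_m, forall j : 'I_n, forall j' : 'I_n,
     (j' == j.+1 :> nat) ==>
     (connection_point (M i j) Right == connection_point (M i j') Left)] &&
  [forall i : 'I_m, forall i' : 'I_m, forall j : 'I_n,
     (i' == i.+1 :> nat) ==>
     (connection_point (M i j) Bottom == connection_point (M i' j) Top)].

Definition suitably_bd_connected (m n : nat) (M : mosaic m n) : bool :=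
  [forall i : 'I_m, forall j : 'I_n, forall j' : 'I_n,
     (j == 0 :> nat) && (j'.+1 == n) ==>
     (connection_point (M i j) Left == connection_point (M i j') Right)] &&
  [forall i : 'I_m, forall i' : 'I_m, forall j : 'I_n,
     (i == 0 :> nat) && (i'.+1 == m) ==>
     (connection_point (M i j) Top == connection_point (M i' j) Bottom)].

Definition period_mosaics (m n : nat) : {set mosaic m n} :=
  [set M : mosaic m n | suitably_connected M && suitably_bd_connected M].

(* N_(i,j) = M_(i-x,j-y), indices modulo m and n: the indices i', j' below are
   the unique representatives of i - x and j - y. *)
Definition cyclic_rotation (m n : nat) (x y : int) (M N : mosaic m n) : Prop :=
  forall (i i' : 'I_m) (j j' : 'I_n),
    (Posz i' = Posz i - x %[mod m])%Z -> (Posz j' = Posz j - y %[mod n])%Z ->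
    N i j = M i' j'.

Definition mosaic_equiv (m n : nat) (M N : mosaic m n) : bool :=
  `[< exists x y : int, cyclic_rotation x y M N >].

Definition toroidal_mosaics (m n : nat) : {set {set mosaic m n}} :=
  equivalence_partition (@mosaic_equiv m n) (period_mosaics m n).

Definition DP (m n : nat) : nat := #|period_mosaics m n|.

Definition DT (m n : nat) : nat := #|toroidal_mosaics m n|.

(* Main.v *)
Require Import Defs.
From mathcomp Require Import all_boot all_order all_algebra.
From mathcomp Require Import boolp.
Import Order.TTheory GRing.Theory Num.Theory.
Local Open Scope ring_scope.

(** Sending a period mosaic to its class is onto the set of toroidal mosaics,
    which gives the upper bound. For the lower bound, a rotation by integers
    depends only on their residues modulo m and n, so a class has at most m n
    members ([card_rotations]); as every period mosaic lies in its own class,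
    the DT classes cover all period mosaics, which thus number at most
    m n DT ([leq_card_equivalence_partition]). *)

Lemma cyclic_rotation0 m n (M : mosaic m n) : cyclic_rotation 0 0 M M.
Proof.
move=> i i' j j'; rewrite !subr0 !modz_nat => -[ei] [ej].
rewrite !modn_small ?ltn_ord // in ei ej.
by rewrite (ord_inj ei) (ord_inj ej).
Qed.

Lemma mosaic_equiv_refl m n : reflexive (@mosaic_equiv m n).
Proof. by move=> M; apply/asboolP; exists 0, 0; apply: cyclic_rotation0. Qed.

(** The additive group structure of the ordinals below [m.+1] is that of the
    integers modulo [m.+1]; [a] and [b] stand for the residues of [- x] and
    [- y] when the rotation is by [x] and [y]. *)
Definition residue_rotation m n (M : mosaic m.+1 n.+1)
    (ab : 'I_m.+1 * 'I_n.+1) : mosaic m.+1 n.+1 :=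
  \matrix_(i, j) M (i + ab.1) (j + ab.2).

Definition residue_opp m (x : int) : 'I_m.+1 := inZp `|(- x %% m.+1)%Z|%N.

Lemma add_residue_opp m (x : int) (i : 'I_m.+1) :
  (Posz (i + residue_opp m x)%R = Posz i - x %[mod m.+1])%Z.
Proof.
rewrite /= -!modz_nat modz_mod PoszD -modz_nat gez0_abs ?modz_ge0 //.
by rewrite modz_mod modzDmr.
Qed.

Lemma cyclic_rotationE m n (M N : mosaic m.+1 n.+1) (x y : int) :
  cyclic_rotation x y M N ->
  N = residue_rotation m n M (residue_opp m x, residue_opp n y).
Proof.
by move=> rotMN; apply/matrixP => i j; rewrite mxE;
  apply: rotMN; apply: add_residue_opp.
Qed.

Lemma card_rotations m n (M : mosaic m.+1 n.+1) :
  (#|[set N | mosaic_equiv M N]| <= m.+1 * n.+1)%N.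
Proof.
have sub : [set N | mosaic_equiv M N] \subset
    [set residue_rotation m n M ab | ab in [set: 'I_m.+1 * 'I_n.+1]].
  apply/subsetP => N; rewrite inE => /asboolP[x [y /cyclic_rotationE ->]].
  by apply: imset_f; rewrite inE.
apply: leq_trans (subset_leq_card sub) _; apply: leq_trans (leq_imset_card _ _) _.
by rewrite cardsT card_prod !card_ord.
Qed.

(** By reflexivity each element of [D] lies in its own class, so the classes,
    each of size at most [k], cover [D]. *)
Lemma leq_card_equivalence_partition (T : finType) (R : rel T) (D : {set T})
    (k : nat) :
    reflexive R -> (forall x, #|[set y | R x y]| <= k)%N ->
  (#|D| <= k * #|equivalence_partition R D|)%N.
Proof.
move=> Rxx leRk; set P := equivalence_partition R D.
have subDP : D \subset cover P.
  apply/subsetP => x Dx; apply/bigcupP; exists [set y in D | R x y].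
    exact: imset_f.
  by rewrite inE Dx Rxx.
apply: leq_trans (subset_leq_card subDP) _.
apply: leq_trans (leq_card_cover P) _.
rewrite mulnC -sum_nat_const; apply: leq_sum => _ /imsetP[x _ ->].
apply: leq_trans (leRk x); apply: subset_leq_card.
by apply/subsetP => y; rewrite !inE => /andP[].
Qed.

Lemma leq_DP_DT m n : (0 < m)%N -> (0 < n)%N -> (DP m n <= m * n * DT m n)%N.
Proof.
case: m n => [//|m] [//|n] _ _.
exact: leq_card_equivalence_partition (@mosaic_equiv_refl _ _)
  (@card_rotations m n).
Qed.

Theorem mainTheorem6 (m n : nat) (hm : (0 < m)%N) (hn : (0 < n)%N) :
  1 / (m%:R * n%:R) * (DP m n)%:R <= (DT m n)%:R :> rat /\
  (DT m n)%:R <= (DP m n)%:R :> rat.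
Proof.
split; last by rewrite ler_nat; apply: leq_imset_card.
rewrite div1r -natrM ler_pdivrMl ?ltr0n ?muln_gt0 ?hm //.
by rewrite -natrM ler_nat leq_DP_DT.
Qed.
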